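(* Let $G$ be a connected cubic graph with $n$ vertices and $m$ edges, where $m$ is odd, and let $e$ be a non-cut edge of $G$. Then $$p(M(G-e))=p(M(G)-e)=2^{m-n}3^{\frac{2n-m-1}{2}}=2^{\frac{n}{2}}3^{\frac{n-2}{4}}.$$
   Context: Graphs are finite and simple. A cubic graph is a graph in which every vertex has degree $3$. For a graph $G$ with vertex set $V(G)$ and edge set $E(G)$, the line graph $L(G)$ has vertex set $E(G)$, two distinct edges of $G$ being adjacent in $L(G)$ if they share an endpoint in $G$. The vertex-edge graph (also called the middle graph) $M(G)$ of $G$ has vertex set $V(G)\cup E(G)$ (disjoint union) and edge set $E(L(G))\cup\{ue,ve : e=uv\in E(G)\}$; that is, two elements of $E(G)$ are adjacent in $M(G)$ if they share an endpoint in $G$, each $e=uv\in E(G)$ is adjacent to its two endpoints $u$ and $v$, and no two elements of $V(G)$ are adjacent. A perfect matching (dimer covering) of a graph is a set of edges such that every vertex is incident with exactly one edge of the set. For a graph $H$, $p(H)$ denotes the number of perfect matchings of $H$. An edge $e$ of a connected graph $G$ is a non-cut edge if the graph $G-e$, obtained from $G$ by deleting the edge $e$ (keeping all vertices), is connected. In $M(G)-e$, $e$ is regarded as a vertex of $M(G)$, and $M(G)-e$ is the graph obtained from $M(G)$ by deleting this vertex and all edges of $M(G)$ incident with it. *)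

(* Defs.v *)
From HB Require Import structures.
From mathcomp Require Import all_boot.

Set Implicit Arguments.
Unset Strict Implicit.
Unset Printing Implicit Defensive.

Record sgraph := SGraph {
  vertex :> finType;
  adj : rel vertex;
  adj_sym : symmetric adj;
  adj_irr : irreflexive adj
}.

(* An edge is the two-element set of its endpoints. *)
Definition edges (G : sgraph) : {set {set G}} :=
  [set [set p.1; p.2] | p : G * G & adj p.1 p.2].

Definition edge (G : sgraph) : finType := {f : {set G} | f \in edges G}.

Definition ends (G : sgraph) (f : edge G) : {set G} := val f.

Definition degree (G : sgraph) (x : G) : nat := #|[set y | adj x y]|.

Definition cubic (G : sgraph) : Prop := forall x : G, degree x = 3.

(* The graph without vertices is not connected. *)
Definition connected (G : sgraph) : Prop :=
  0 < #|G| /\ forall x y : G, connect (@adj G) x y.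

Section EdgeDeletion.
Variables (G : sgraph) (f : edge G).

Definition del_edge_adj : rel G :=
  fun x y => adj x y && ([set x; y] != ends f).

Lemma del_edge_adj_sym : symmetric del_edge_adj.
Proof. by move=> x y; rewrite /del_edge_adj adj_sym setUC. Qed.

Lemma del_edge_adj_irr : irreflexive del_edge_adj.
Proof. by move=> x; rewrite /del_edge_adj adj_irr. Qed.

Definition del_edge : sgraph := SGraph del_edge_adj_sym del_edge_adj_irr.

End EdgeDeletion.

Definition non_cut_edge (G : sgraph) (f : edge G) : Prop :=
  connected (del_edge f).

Section VertexDeletion.
Variables (G : sgraph) (v : G).

Definition del_vertex_adj : rel {x : G | x != v} :=
  fun x y => adj (val x) (val y).

Lemma del_vertex_adj_sym : symmetric del_vertex_adj.
Proof. by move=> x y; rewrite /del_vertex_adj adj_sym. Qed.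

Lemma del_vertex_adj_irr : irreflexive del_vertex_adj.
Proof. by move=> x; rewrite /del_vertex_adj adj_irr. Qed.

Definition del_vertex : sgraph := SGraph del_vertex_adj_sym del_vertex_adj_irr.

End VertexDeletion.

Section LineGraph.
Variable G : sgraph.

Definition line_adj : rel (edge G) :=
  fun f g => (f != g) && (ends f :&: ends g != set0).

Lemma line_adj_sym : symmetric line_adj.
Proof. by move=> f g; rewrite /line_adj eq_sym setIC. Qed.

Lemma line_adj_irr : irreflexive line_adj.
Proof. by move=> f; rewrite /line_adj eqxx. Qed.

Definition line_graph : sgraph := SGraph line_adj_sym line_adj_irr.

End LineGraph.

Section MiddleGraph.
Variable G : sgraph.

Definition middle_adj : rel (G + edge G)%type :=
  fun a b =>
    match a, b with
    | inl _, inl _ => false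
    | inl u, inr f => u \in ends f
    | inr f, inl u => u \in ends f
    | inr f, inr g => @adj (line_graph G) f g
    end.

Lemma middle_adj_sym : symmetric middle_adj.
Proof. by case=> [u|f] [v|g] //; apply: line_adj_sym. Qed.

Lemma middle_adj_irr : irreflexive middle_adj.
Proof. by case=> [u|f] //; apply: line_adj_irr. Qed.

Definition middle_graph : sgraph := SGraph middle_adj_sym middle_adj_irr.

Definition middle_of_edge (f : edge G) : middle_graph := inr f.

End MiddleGraph.

Definition perfect_matching (H : sgraph) (M : {set {set H}}) : bool :=
  (M \subset edges H) && [forall x : H, #|[set f in M | x \in f]| == 1].

Definition num_perfect_matchings (H : sgraph) : nat :=
  #|[set M : {set {set H}} | perfect_matching M]|.

(* Main.v *)
(* [M(H)] is the edge-disjoint union of the cliques on [v] and its incident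
   edges, for [v] a vertex of [H].  A perfect matching therefore orients every
   edge of [H] towards the vertex whose clique contains its partner, and all
   indegrees are odd.  For [H = G - e] the indegrees are 1 or 3, and an indegree
   3 leaves 3 ways to match the corresponding clique.  The sum of the indegrees
   is [m - 1], so the number of vertices of indegree 3 is always
   [(m - 1 - n) / 2].  Reversing the edges of a path toggles the parity of the
   indegrees of its ends only, so in the connected graph [H] all sets of vertices
   of the right parity are equally often the set of vertices of odd indegree;
   hence there are [2 ^ (m - n)] orientations with all indegrees odd. *)

Require Import Defs.
From HB Require Import structures.
From mathcomp Require Import all_boot.
From mathcomp Require Import zify.

Set Implicit Arguments.
Unset Strict Implicit.
Unset Printing Implicit Defensive.

(** * Edges, incidence and the handshake identity *)

Lemma set2_inj (T : finType) (x y z : T) : [set x; y] = [set x; z] -> y = z.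
Proof.
move=> /setP E; have := E y; have := E z; rewrite !inE !eqxx !orbT.
by case/orP=> /eqP zE; case/esym/orP => /eqP yE; rewrite zE yE.
Qed.

Lemma edgesP (G : sgraph) (f : {set G}) :
  reflect (exists x y, adj x y /\ f = [set x; y]) (f \in edges G).
Proof.
apply: (iffP imsetP) => [[[x y] xy ->]|[x [y [xy ->]]]].
  by rewrite inE in xy; exists x, y.
by exists (x, y); rewrite ?inE.
Qed.

Lemma set2_edge (G : sgraph) (x y : G) : ([set x; y] \in edges G) = adj x y.
Proof.
apply/edgesP/idP => [[u [v [uv]]]|xy]; last by exists x, y.
move=> /setP E; have := E v; have := E u; rewrite !inE !eqxx orbT.
case/orP=> /eqP Eu; case/orP=> /eqP Ev; move: uv; rewrite Eu Ev ?adj_irr //.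
by rewrite adj_sym.
Qed.

Lemma card_ends (G : sgraph) (f : edge G) : #|ends f| = 2.
Proof.
have /edgesP[x [y [xy E]]] := valP f; rewrite /ends E cards2.
by case: eqP xy => // ->; rewrite adj_irr.
Qed.

Lemma ends_inj (G : sgraph) : injective (@ends G).
Proof. exact: val_inj. Qed.

Lemma card_edge (G : sgraph) : #|edge G| = #|edges G|.
Proof. exact: card_sig. Qed.

Lemma edgeP (G : sgraph) (f : edge G) (x : G) :
  x \in ends f -> exists2 y, adj x y & ends f = [set x; y].
Proof.
have /edgesP[u [v [uv E]]] := valP f; rewrite /ends E !inE => /orP[]/eqP->.
  by exists v.
by exists u; rewrite 1?adj_sym // setUC.
Qed.

(** In a simple graph two ends determine the edge. Hence the vertex at which two adjacent edges meet
    is well defined. *)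
Lemma common_end_unique (G : sgraph) (f g : edge G) (x y : G) :
  f != g -> x \in ends f -> x \in ends g -> y \in ends f -> y \in ends g ->
  x = y.
Proof.
move=> fg xf xg yf yg; apply/eqP; apply: contraNT fg => xy.
have H (h : edge G) : x \in ends h -> y \in ends h -> ends h = [set x; y].
  move=> xh yh; apply/eqP; rewrite eq_sym eqEcard card_ends cards2 xy andbT.
  by apply/subsetP => z; rewrite !inE => /orP[]/eqP->.
by apply/eqP/ends_inj; rewrite (H f) // (H g).
Qed.

Lemma card_incident (G : sgraph) (x : G) :
  #|[set f : edge G | x \in ends f]| = degree x.
Proof.
rewrite /degree -(card_imset _ val_inj).
have /card_imset <- : injective (fun y => [set x; y]) by apply: set2_inj.
apply: eq_card => f; apply/imsetP/imsetP => [[g]|[y]].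
  by rewrite inE => /edgeP[y xy E] ->; exists y; rewrite ?inE.
rewrite inE => xy ->; have h : [set x; y] \in edges G by rewrite set2_edge.
by exists (Sub [set x; y] h : edge G); rewrite // inE; apply: set21.
Qed.

(** Double counting of the incident vertex-edge pairs. *)
Lemma handshake (G : sgraph) : \sum_(x : G) degree x = 2 * #|edges G|.
Proof.
under eq_bigr => x _ do rewrite -card_incident -sum1dep_card big_mkcond.
rewrite exchange_big -card_edge mulnC -sum_nat_const.
apply: eq_bigr => f _; rewrite -(card_ends f) -sum1_card.
by rewrite [RHS]big_mkcond.
Qed.

(** * Perfect matchings as involutions *)

(** A perfect matching is encoded by the map sending each vertex to its partner. *)
Definition matching_involutions (H : sgraph) : {set {ffun H -> H}} :=
  [set p : {ffun H -> H} | [forall x, adj x (p x) && (p (p x) == x)]].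

Lemma matching_involutionsP (H : sgraph) (p : {ffun H -> H}) :
  reflect (forall x, adj x (p x) /\ p (p x) = x) (p \in matching_involutions H).
Proof.
rewrite inE; apply: (iffP forallP) => h x; have := h x.
  by case/andP=> -> /eqP.
by case=> -> ->; rewrite eqxx.
Qed.

(** The involution [p] corresponds to the set of all pairs [[set x; p x]]; conversely [p x] is read
    off from the unique matching edge at [x]. *)
Lemma num_perfect_matchingsE (H : sgraph) :
  num_perfect_matchings H = #|matching_involutions H|.
Proof.
pose F (p : {ffun H -> H}) := [set [set x; p x] | x : H].
have F_inj : {in matching_involutions H &, injective F}.
  move=> p q /matching_involutionsP hp /matching_involutionsP hq E.
  apply/ffunP => x; apply: (@set2_inj _ x).
  have : [set x; p x] \in F q by rewrite -E; apply: imset_f.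
  case/imsetP => y _ Exy; have : x \in [set x; p x] by rewrite !inE eqxx.
  rewrite {1}Exy !inE => /orP[]/eqP xy; rewrite Exy xy //.
  by rewrite (hq y).2 setUC.
rewrite /num_perfect_matchings -(card_in_imset F_inj); apply: eq_card => M.
rewrite inE; apply/andP/imsetP => [[/subsetP ME /forallP M1]|[p + ->]].
  have M2 x : exists y, [set x; y] \in M.
    have /cards1P[f /setP/(_ f)] := M1 x; rewrite !inE eqxx => /andP[fM xf].
    have fE := ME _ fM; have [y _ E] := edgeP (f := Sub f fE) xf.
    by exists y; rewrite -E.
  have M3 x f g : f \in M -> g \in M -> x \in f -> x \in g -> f = g.
    have /cards1P[h /setP E] := M1 x; have := E f; have := E g.
    rewrite !inE => + + fM gM xf xg; rewrite fM gM xf xg.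
    by move=> /esym/eqP-> /esym/eqP->.
  pose p := [ffun x => xchoose (M2 x)]; have pM x : [set x; p x] \in M.
    by rewrite ffunE; apply: (xchooseP (M2 x)).
  exists p.
    apply/matching_involutionsP => x; split; first by rewrite -set2_edge ME.
    apply: (@set2_inj _ (p x)); rewrite [RHS]setUC.
    by apply: (M3 (p x)); rewrite ?pM // !inE eqxx ?orbT.
  apply/setP=> f; apply/idP/imsetP => [fM|[x _ ->//]].
  have /edgesP[x [y [xy Ef]]] := ME _ fM; exists x => //.
  by apply: (M3 x); rewrite ?pM // ?Ef !inE eqxx.
move=> /matching_involutionsP hp; split.
  by apply/subsetP => f /imsetP[x _ ->]; rewrite set2_edge (hp x).1.
apply/forallP => x; apply/cards1P; exists [set x; p x]; apply/setP => f.
rewrite !inE; apply/andP/eqP => [[/imsetP[y _ ->]]|->].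
  by rewrite !inE => /orP[]/eqP-> //; rewrite (hp y).2 setUC.
by rewrite !inE eqxx; split => //; apply: imset_f.
Qed.

Lemma num_perfect_matchings_iso (H K : sgraph) (h : H -> K) :
  bijective h -> {mono h : x y / adj x y} ->
  num_perfect_matchings H = num_perfect_matchings K.
Proof.
have leq (A B : sgraph) (f : A -> B) (g : B -> A) : cancel f g -> cancel g f ->
    {mono f : x y / adj x y} ->
    #|matching_involutions A| <= #|matching_involutions B|.
  move=> fK gK fM; pose F (p : {ffun A -> A}) := [ffun x => f (p (g x))].
  have F_inj : injective F.
    move=> p q /ffunP E; apply/ffunP => x; have := E (f x).
    by rewrite !ffunE fK => /(can_inj fK).
  rewrite -(card_imset _ F_inj); apply: subset_leq_card.
  apply/subsetP => _ /imsetP[p /matching_involutionsP hp ->].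
  apply/matching_involutionsP => x; rewrite !ffunE fK (hp _).2 gK.
  by rewrite -{1}(gK x) fM (hp _).1.
case=> k hK kK hM; rewrite !num_perfect_matchingsE; apply/eqP.
rewrite eqn_leq (leq _ _ h k) // (leq _ _ k h) // => x y.
by rewrite -hM !kK.
Qed.

(** * Orientations with prescribed indegree parities *)

Section Orientations.
Variable H : sgraph.
Implicit Types (o : {ffun edge H -> H}) (D : {set H}) (x y v : H).

(** An orientation is given by the head [o f] of each edge [f]. *)
Definition orientations : {set {ffun edge H -> H}} :=
  [set o in family (fun f : edge H => mem (ends f))].

Definition in_edges o v : {set edge H} := [set f | o f == v].

Definition odd_set o : {set H} := [set v | odd #|in_edges o v|].

Lemma orientationsP o :
  reflect (forall f, o f \in ends f) (o \in orientations).
Proof. by rewrite inE; apply: familyP. Qed.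

Lemma card_orientations : #|orientations| = 2 ^ #|edges H|.
Proof.
rewrite cardsE card_family -card_edge -prod_nat_const.
rewrite foldrE big_map big_enum /=.
by apply: eq_bigr => f _; apply: card_ends.
Qed.

Lemma sum_in_edges o : \sum_v #|in_edges o v| = #|edges H|.
Proof.
rewrite -card_edge -sum1_card (partition_big o predT) //=.
by apply: eq_bigr => v _; rewrite sum1dep_card.
Qed.

Lemma odd_card_odd_set o : odd #|odd_set o| = odd #|edges H|.
Proof.
rewrite -(sum_in_edges o) -sum1_card big_mkcond.
elim/big_rec2: _ => //= v a b _ E; rewrite !oddD E inE.
by case: (odd #|_|).
Qed.

Definition toggle x D : {set H} := [set v | (v \in D) (+) (v == x)].

Lemma toggleK x : involutive (toggle x).
Proof. by move=> D; apply/setP => v; rewrite !inE -addbA addbb addbF. Qed.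

Lemma toggleC x y D : toggle x (toggle y D) = toggle y (toggle x D).
Proof. by apply/setP => v; rewrite !inE addbAC. Qed.

Definition num_orientations D : nat :=
  #|[set o in orientations | odd_set o == D]|.

(** Reversing the edge [xy] is an involution on orientations that changes the indegree parity at [x]
    and [y] only. *)
Lemma num_orientations_adj x y D :
  adj x y -> num_orientations (toggle x (toggle y D)) = num_orientations D.
Proof.
move=> xy; have xyE : [set x; y] \in edges H by rewrite set2_edge.
have nxy : x != y by apply: contraTneq xy => ->; rewrite adj_irr.
pose g : edge H := Sub [set x; y] xyE.
have gE : ends g = [set x; y] by [].
pose flip o := [ffun f => if f == g then if o f == x then y else x else o f].
have flipK : {in orientations, cancel flip flip}.
  move=> o /orientationsP ho; apply/ffunP => f; rewrite !ffunE.
  case: (f =P g) => // ->; have := ho g; rewrite gE !inE => /orP[]/eqP->.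
    by rewrite !eqxx [y == x]eq_sym (negPf nxy).
  by rewrite [y == x]eq_sym (negPf nxy) eqxx.
have flip_or o : o \in orientations -> flip o \in orientations.
  move=> /orientationsP ho; apply/orientationsP => f; rewrite ffunE.
  by case: eqP => // ->; rewrite gE; case: ifP; rewrite !inE eqxx ?orbT.
have flip_odd o : o \in orientations ->
    odd_set (flip o) = toggle x (toggle y (odd_set o)).
  move=> /orientationsP/(_ g); rewrite gE !inE => og; apply/setP => v.
  rewrite !inE -!sum1dep_card big_mkcond [in RHS]big_mkcond /=.
  (* Only the summand of [g] is affected by the reversal; the other edges contribute the same parity
     [b] on both sides. *)
  rewrite (bigD1 g) // [in RHS](bigD1 g) //=.
  under eq_bigr => f /negPf fg do rewrite ffunE fg.
  rewrite !oddD ffunE eqxx; move: (odd (\sum_(_ | _) _)) => b.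
  rewrite -!addbA addbC [in RHS]addbC -addbA; congr addb.
  case/orP: og => /eqP->; rewrite ?eqxx 1?[y == x]eq_sym ?(negPf nxy);
   rewrite ![_ == v]eq_sym; case: (v =P x) => [->|_];
   rewrite ?(negPf nxy); by case: (v == y).
have le D' : num_orientations D' <=
    num_orientations (toggle x (toggle y D')).
  have inj : {in [set o in orientations | odd_set o == D'] &, injective flip}.
    move=> o p; rewrite in_set => /andP[ho _]; rewrite in_set => /andP[hp _] E.
    by rewrite -(flipK o) // E flipK.
  rewrite /num_orientations -(card_in_imset inj); apply: subset_leq_card.
  apply/subsetP => _ /imsetP[o + ->]; rewrite in_set => /andP[ho /eqP oD].
  by rewrite in_set flip_or // flip_odd // oD eqxx.
(* The reverse inequality is [le] at the toggled set, where the toggles cancel. *)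
apply/eqP; rewrite eqn_leq le andbT; apply: leq_trans (le _) _.
by rewrite [toggle x (toggle y D)]toggleC toggleK toggleK.
Qed.

(** Induction along a path: at each inner vertex the two toggles cancel. *)
Lemma num_orientations_connect x y D :
  connect (@adj H) x y ->
  num_orientations (toggle x (toggle y D)) = num_orientations D.
Proof.
case/connectP => p; elim: p x => [|z p IH] x /=.
  by move=> _ ->; rewrite toggleK.
case/andP=> xz /IH{}IH /IH <-.
by rewrite -[toggle y D](toggleK z) num_orientations_adj // toggleK.
Qed.

(* Pairing each target set with its toggle at a fixed root removes the parity
   constraint, so that the paired count is the same for all subsets. *)
Lemma num_odd_orientations :
  connected H -> ~~ odd (#|H| + #|edges H|) ->
  2 ^ #|H| * num_orientations setT = 2 ^ #|edges H|.+1.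
Proof.
case=> /card_gt0P[r _] Hc ev.
pose N D := num_orientations D + num_orientations (toggle r D).
(* Toggling at both [x] and [r] preserves the count, so toggling at [x] swaps the two terms of
   [N D]. *)
have Nt x D : N (toggle x D) = N D.
  rewrite /N addnC num_orientations_connect //; congr addn.
  rewrite -(num_orientations_connect (x := r) (y := x)) //.
  by rewrite toggleK.
have N0 D : N D = N set0.
  have [k] := ubnP #|D|; elim: k D => // k IH D; rewrite ltnS => kD.
  have [->//|[x xD]] := set_0Vmem D; rewrite -(Nt x) IH //.
  have -> : toggle x D = D :\ x.
    by apply/setP => v; rewrite !inE; case: eqP => [->|]; rewrite ?xD ?addbF.
  by move: kD; rewrite (cardsD1 x) xD.
(* The second term vanishes: the complement of [r] has the wrong parity to be an odd set. *)
have <- : N setT = num_orientations setT.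
  rewrite /N; suff -> : num_orientations (toggle r setT) = 0 by rewrite addn0.
  apply: eq_card0 => o; rewrite in_set; apply: contraNF ev => /andP[_ /eqP E].
  rewrite oddD -(odd_card_odd_set o) E.
  have -> : toggle r setT = [set~ r] by apply/setP => v; rewrite !inE.
  rewrite cardsC1; have : 0 < #|H| by apply/card_gt0P; exists r.
  by case: #|H| => //= k _; case: odd.

have S : \sum_D num_orientations D = 2 ^ #|edges H|.
  rewrite -card_orientations -sum1_card (partition_big odd_set predT) //=.
  by apply: eq_bigr => D _; rewrite sum1dep_card.
have : \sum_D N D = 2 ^ #|edges H|.+1.
  rewrite big_split /= S -(reindex_inj (P := predT) (inv_inj (toggleK r))) S.
  by rewrite addnn -mul2n expnS.
under eq_bigr => D _ do rewrite N0.
rewrite sum_nat_const N0 => <-; congr (_ * _).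
by rewrite -cardsT -card_powerset powersetT cardsT.
Qed.

End Orientations.

(** * Matchings of the middle graph as orientations with choices *)

(** Choosing a related element of [B] for each element of [A] gives an injection. Used in both
    directions, this compares matchings and choices through one relation. *)
Lemma leq_card_rel (S T : finType) (R : S -> T -> bool) (A : {set S})
    (B : {set T}) :
  (forall a, a \in A -> exists2 b, b \in B & R a b) ->
  (forall a a' b, a \in A -> a' \in A -> b \in B -> R a b -> R a' b -> a = a') ->
  #|A| <= #|B|.
Proof.
move=> ex un; pose F a := [pick b | (b \in B) && R a b].
have FP a : a \in A -> exists b, [/\ F a = Some b, b \in B & R a b].
  move=> /ex[b bB ab]; rewrite /F; case: pickP => [b' /andP[]|/(_ b)].
    by exists b'.
  by rewrite bB ab.
have F_inj : {in A &, injective F}.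
  move=> a a' aA a'A E; have [b [Eb bB ab]] := FP a aA.
  have [b' [Eb' _ ab']] := FP a' a'A; apply: (un _ _ b) => //.
  by move: E ab'; rewrite Eb Eb' => -[->].
rewrite -(card_in_imset F_inj) -(card_imset (mem B) Some_inj).
apply: subset_leq_card; apply/subsetP => _ /imsetP[a /FP[b [-> bB _]] ->].
exact: imset_f.
Qed.

Section MiddleMatchings.
Variable H : sgraph.
Hypothesis subcubic : forall v : H, degree v <= 3.
Implicit Types (o : {ffun edge H -> H}) (c : {ffun H -> edge H}).
Implicit Types p : {ffun middle_graph H -> middle_graph H}.

(* A matching is encoded by the orientation [o] it induces and the partners [c]
   of the vertices of [H]: with indegrees 1 and 3, the in-edges of [v] other than
   [c v] are absent or matched with each other. *)
Definition odd_choices : {set {ffun edge H -> H} * {ffun H -> edge H}} :=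
  [set q | [&& q.1 \in orientations H, odd_set q.1 == setT &
            q.2 \in family (fun v => mem (in_edges q.1 v))]].

Lemma odd_choicesP o c :
  reflect [/\ forall f, o f \in ends f, forall v, odd #|in_edges o v| &
           forall v, o (c v) = v] ((o, c) \in odd_choices).
Proof.
rewrite inE /=; apply: (iffP and3P).
  case=> /orientationsP ho /eqP/setP ood /familyP hc; split=> // v.
    by have := ood v; rewrite !inE.
  by have := hc v; rewrite inE => /eqP.
case=> ho ood hc; split; first exact/orientationsP.
  by apply/eqP/setP => v; rewrite !inE ood.
by apply/familyP => v; rewrite inE hc.
Qed.

Lemma card_in_edges_le3 o v : o \in orientations H -> #|in_edges o v| <= 3.
Proof.
move=> /orientationsP ho; apply: leq_trans (subcubic v).
rewrite -card_incident; apply: subset_leq_card.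
by apply/subsetP => f; rewrite !inE => /eqP <-.
Qed.

(** The possible partners of [f] when [f] is not matched to its head. *)
Definition others o c f : {set edge H} := in_edges o (o f) :\ c (o f) :\ f.

(** The indegree at [o f] is odd, at most 3, and counts the two distinct edges [f] and [c (o f)]; so
    it is 3 and one edge remains. *)
Lemma card_others o c f :
  (o, c) \in odd_choices -> f != c (o f) -> exists g, others o c f = [set g].
Proof.
case/odd_choicesP => ho ood hc fc; apply/cards1P.
have oo : o \in orientations H by apply/orientationsP.
have := ood (o f); have := card_in_edges_le3 (o f) oo.
rewrite (cardsD1 (c (o f)) (in_edges _ _)) (cardsD1 f (_ :\ _)) !inE hc !eqxx fc.
rewrite -/(others o c f).
by case: #|others o c f| => [|[|]].
Qed.

(** The vertex whose clique is assigned to [a]: an edge belongs to the clique of its head. *)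
Definition choice_class o (a : middle_graph H) : H :=
  match a with inl v => v | inr f => o f end.

Definition matching_choice p (q : {ffun edge H -> H} * {ffun H -> edge H}) :=
  [forall v, p (inl v) == inr (q.2 v)] &&
  [forall f, choice_class q.1 (p (inr f)) == q.1 f].

Lemma matching_choiceP p o c :
  reflect ((forall v, p (inl v) = inr (c v)) /\
           (forall f, choice_class o (p (inr f)) = o f))
    (matching_choice p (o, c)).
Proof.
apply: (iffP andP) => /= -[h1 h2].
  by split=> a; [apply: (eqP (forallP h1 a)) | apply: (eqP (forallP h2 a))].
by split; apply/forallP => a; rewrite ?h1 ?h2.
Qed.

Lemma choice_of_matching p :
  p \in matching_involutions (middle_graph H) ->
  exists2 q, q \in odd_choices & matching_choice p q.
Proof.
move=> /matching_involutionsP hp.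
have exc v : exists f, p (inl v) == inr f.
  by case E: (p (inl v)) (hp (inl v)) => [w|f] [] //; exists f.
(* The head of [f] is an end shared with its partner edge, or the partner itself if that is a
   vertex. *)
have exo f : exists v, (v \in ends f) &&
    (if p (inr f) is inr g then v \in ends g else p (inr f) == inl v).
  case E: (p (inr f)) (hp (inr f)) => [v|g] [/= fg _].
    by exists v; rewrite fg /=.
  by case/andP: fg => _ /set0Pn[v]; rewrite inE; exists v.
pose c := [ffun v => xchoose (exc v)]; pose o := [ffun f => xchoose (exo f)].
have cP v : p (inl v) = inr (c v) by rewrite ffunE; apply/eqP/(xchooseP (exc v)).
have oP f : (o f \in ends f) && (if p (inr f) is inr g then o f \in ends g
    else p (inr f) == inl (o f)) by rewrite ffunE; apply: (xchooseP (exo f)).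
have oE f : o f \in ends f by case/andP: (oP f).
have clP f : choice_class o (p (inr f)) = o f.
  have /andP[_] := oP f; have [] := hp (inr f).
  case E: (p (inr f)) => [v|g] /=; first by move=> _ _ /eqP[->].
  move=> /andP[fg _] E' fg'; have /andP[_] := oP g; rewrite E' => gf'.
  exact: common_end_unique fg _ _ _ _.
have ocP v : o (c v) = v by rewrite -clP -cP (hp _).2.
have oo : o \in orientations H by apply/orientationsP.
exists (o, c); last exact/matching_choiceP.
apply/odd_choicesP; split => // v; have := card_in_edges_le3 v oo.
(* Only indegree 2 must be excluded: the in-edge [g] other than [c v] would have no partner, since
   [v] and [c v] are matched to each other. *)
rewrite (cardsD1 (c v)) inE ocP eqxx.
case D: #|_| => [|[|[]]] //; move/eqP: D => /cards1P[g Dg].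
have : g \in in_edges o v :\ c v by rewrite Dg inE.
rewrite !inE => /andP[gc /eqP og]; have := clP g.
case E: (p (inr g)) (hp (inr g)) => [w|h] [ad E'] /= cl.
  by move: E'; rewrite cl og cP => -[] cg; rewrite cg eqxx in gc.
have : h \in in_edges o v :\ c v.
  rewrite !inE cl og eqxx andbT; apply/eqP => hc.
  by move: E'; rewrite hc -cP (hp _).2.
by rewrite Dg inE => /eqP hg; rewrite hg adj_irr in ad.
Qed.

Lemma matching_of_choice q :
  q \in odd_choices ->
  exists2 p, p \in matching_involutions (middle_graph H) & matching_choice p q.
Proof.
case: q => o c hq; have [ho ood hc] := odd_choicesP _ _ hq.
(* The last [inl (o f)] is a default never reached, since [others o c f] is a singleton whenever
   [f != c (o f)]. *)
pose p : {ffun middle_graph H -> middle_graph H} := [ffun a => match a with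
  | inl v => inr (c v)
  | inr f => if f == c (o f) then inl (o f)
             else if [pick g in others o c f] is Some g then inr g
             else inl (o f) end].
have pl v : p (inl v) = inr (c v) by rewrite ffunE.
have pc f : f = c (o f) -> p (inr f) = inl (o f).
  by move=> E; rewrite ffunE -E eqxx.
have po f : f != c (o f) -> exists2 g, others o c f = [set g] & p (inr f) = inr g.
  move=> fc; have [g E] := card_others hq fc; exists g => //.
  rewrite ffunE (negPf fc) E; case: pickP => [h|/(_ g)]; last by rewrite inE eqxx.
  by rewrite inE => /eqP->.
have gP f g : others o c f = [set g] -> [/\ g != f, g != c (o f) & o g = o f].
  by move=> /setP/(_ g); rewrite !inE eqxx => /and3P[-> -> /eqP].
exists p; last first.
  apply/matching_choiceP; split=> // f.
  have [/pc -> //|/po[g /gP[_ _ E] ->]] := eqVneq f (c (o f)).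
  exact: E.
apply/matching_involutionsP => -[v|f].
  by rewrite pl pc hc //=; split=> //; rewrite -{1}(hc v).
have [E|fc] := eqVneq f (c (o f)); first by rewrite pc //= pl -E.
have [g E ->] := po f fc; have [gf gc og] := gP _ _ E; split.
  rewrite /= /line_adj eq_sym gf; apply/set0Pn; exists (o f).
  by rewrite inE ho -og ho.
have [|h Eh ->] := po g; first by rewrite og.
congr inr; apply/eqP; have : f \in others o c g.
  by rewrite !inE eq_sym gf og eqxx fc.
by rewrite Eh inE eq_sym.
Qed.

(** The partner of every edge is forced: its head if [f = c (o f)], and otherwise the only element
    of [others o c f]. *)
Lemma matching_unique p p' q :
  p \in matching_involutions (middle_graph H) ->
  p' \in matching_involutions (middle_graph H) -> q \in odd_choices ->
  matching_choice p q -> matching_choice p' q -> p = p'.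
Proof.
case: q => o c Hp Hp' hq Rp Rp'; have [ho ood hc] := odd_choicesP _ _ hq.
have pc r f : r \in matching_involutions (middle_graph H) ->
    matching_choice r (o, c) -> f = c (o f) -> r (inr f) = inl (o f).
  move=> /matching_involutionsP hr /matching_choiceP[rl _] E.
  by rewrite {1}E -rl (hr _).2.
have po r f : r \in matching_involutions (middle_graph H) ->
    matching_choice r (o, c) -> f != c (o f) ->
    exists2 g, r (inr f) = inr g & g \in others o c f.
  move=> /matching_involutionsP hr /matching_choiceP[rl ro] fc.
  have := ro f; case E: (r (inr f)) (hr (inr f)) => [v|g] [ad E'] /= cl.
    by move: E'; rewrite cl rl => -[] cf; rewrite cf eqxx in fc.
  exists g; first exact: erefl.
  rewrite in_setD1 in_setD1 in_set; apply/and3P; split; last exact/eqP.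
    by apply: contraTneq ad => ->; rewrite adj_irr.
  by apply/eqP => gc; move: E'; rewrite gc -rl (hr _).2.
apply/ffunP => -[v|f].
  by case/matching_choiceP: Rp => -> _; case/matching_choiceP: Rp' => -> _.
have [E|fc] := eqVneq f (c (o f)); first by rewrite !pc.
have [g -> +] := po _ _ Hp Rp fc; have [g' -> +] := po _ _ Hp' Rp' fc.
by have [h ->] := card_others hq fc; rewrite !inE => /eqP-> /eqP->.
Qed.

(** The choice [c] is read off from the partners of vertices; the head of an edge is its partner
    vertex or the unique end shared with its partner edge. *)
Lemma choice_unique q q' p :
  q \in odd_choices -> q' \in odd_choices ->
  p \in matching_involutions (middle_graph H) ->
  matching_choice p q -> matching_choice p q' -> q = q'.
Proof.
case: q q' => o c [o' c'] /odd_choicesP[ho _ _] /odd_choicesP[ho' _ _].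
move=> /matching_involutionsP hp /matching_choiceP[h1 h2] /matching_choiceP[h1' h2'].
congr pair; last by apply/ffunP => v; have := h1 v; rewrite h1' => -[].
apply/ffunP => f; have := h2 f; have := h2' f.
case E: (p (inr f)) (hp (inr f)) => [v|g] [/= ad _]; first by move=> <- <-.
case/andP: ad => fg _ E1 E2; apply: (common_end_unique fg) => //.
  by rewrite -E2.
by rewrite -E1.
Qed.

Lemma card_matchings_choices :
  num_perfect_matchings (middle_graph H) = #|odd_choices|.
Proof.
rewrite num_perfect_matchingsE; apply/eqP; rewrite eqn_leq.
rewrite (leq_card_rel choice_of_matching matching_unique) /=.
exact: (@leq_card_rel _ _ (fun q p => matching_choice p q) _ _
          matching_of_choice choice_unique).
Qed.

(** Each indegree is 1 or 3, hence equals both [1 + 2 * b v] and [3 ^ b v]; summing the first form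
    determines the total of the exponents [b v]. *)
Lemma prod_in_edges o :
  o \in orientations H -> odd_set o = setT ->
  \prod_v #|in_edges o v| = 3 ^ ((#|edges H| - #|H|) %/ 2).
Proof.
move=> oo /setP ood; pose b v := #|in_edges o v|./2.
have bP v : #|in_edges o v| = 1 + 2 * b v /\ #|in_edges o v| = 3 ^ b v.
  have := ood v; have := card_in_edges_le3 v oo; rewrite /b !inE.
  by case: #|_| => [|[|[|[|]]]].
under eq_bigr => v _ do rewrite (bP v).2.
rewrite -expn_sum -(sum_in_edges o).
under [in RHS]eq_bigr => v _ do rewrite (bP v).1.
by rewrite big_split /= sum1_card -big_distrr /= addKn mulKn.
Qed.

Lemma card_odd_choices :
  #|odd_choices| =
  num_orientations (setT : {set H}) * 3 ^ ((#|edges H| - #|H|) %/ 2).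
Proof.
rewrite /num_orientations -sum_nat_const -sum1dep_card.
rewrite (eq_bigl (fun q : {ffun edge H -> H} * {ffun H -> edge H} =>
  (q.1 \in [set o in orientations H | odd_set o == setT]) &&
  (q.2 \in family (fun v => mem (in_edges q.1 v))))); last first.
  by move=> q; rewrite [in RHS]inE andbA.
rewrite -(pair_big_dep (fun o => o \in [set o in orientations H | odd_set o == setT])
  (fun o c => c \in family (fun v => mem (in_edges o v))) (fun _ _ => 1)) /=.
apply: eq_bigr => o; rewrite inE => /andP[oo /eqP ood].
by rewrite sum1_card card_family foldrE big_map big_enum /= prod_in_edges.
Qed.

(** The factor [2 ^ #|H|] on the left avoids a truncated subtraction in the exponent. *)
Lemma num_perfect_matchings_middle :
  connected H -> ~~ odd (#|H| + #|edges H|) ->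
  2 ^ #|H| * num_perfect_matchings (middle_graph H) =
  2 ^ #|edges H|.+1 * 3 ^ ((#|edges H| - #|H|) %/ 2).
Proof.
move=> Hc ev; rewrite card_matchings_choices card_odd_choices mulnA.
by rewrite num_odd_orientations.
Qed.

End MiddleMatchings.

(** * Deleting an edge of the graph or a vertex of its middle graph *)

Section DeleteEdge.
Variables (G : sgraph) (e : edge G).

Lemma edges_del_edge : edges (del_edge e) = edges G :\ ends e.
Proof.
apply/setP => f; rewrite in_setD1; apply/edgesP/andP.
  by case=> x [y [/andP[xy ne] ->]]; split=> //; apply/(@edgesP G); exists x, y.
case=> fe /(@edgesP G)[x [y [xy E]]]; exists x, y.
by rewrite /= /del_edge_adj xy -E.
Qed.

Lemma card_edges_del_edge : #|edges (del_edge e)| = #|edges G|.-1.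
Proof. by rewrite edges_del_edge (cardsD1 (ends e) (edges G)) (valP e). Qed.

Lemma degree_del_edge (v : G) : @degree (del_edge e) v <= degree v.
Proof.
by apply: subset_leq_card; apply/subsetP => w; rewrite !inE => /andP[].
Qed.

Lemma edge_of_del_edge_proof (f : edge (del_edge e)) :
  val f \in edges G :\ ends e.
Proof. by rewrite -edges_del_edge; apply: valP. Qed.

Definition edge_of_del_edge (f : edge (del_edge e)) : edge G :=
  Sub (val f) (subsetP (subD1set _ _) _ (edge_of_del_edge_proof f)).

Lemma edge_of_del_edge_neq f : edge_of_del_edge f != e.
Proof.
have /setD1P[ne _] := edge_of_del_edge_proof f.
by apply: contraNneq ne => /(congr1 val)/eqP.
Qed.

(** The two graphs are isomorphic: edges keep their ends, which alone determine adjacency in the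
    middle graph. *)
Lemma num_perfect_matchings_del_vertex :
  num_perfect_matchings (middle_graph (del_edge e)) =
  num_perfect_matchings (del_vertex (middle_of_edge e)).
Proof.
pose h0 (a : middle_graph (del_edge e)) : middle_graph G :=
  match a with inl v => inl v | inr f => inr (edge_of_del_edge f) end.
have h0P a : h0 a != middle_of_edge e.
  case: a => //= f; apply/eqP => -[] /eqP.
  by rewrite (negPf (edge_of_del_edge_neq f)).
pose h (a : middle_graph (del_edge e)) : del_vertex (middle_of_edge e) :=
  exist _ (h0 a) (h0P a).
apply: (@num_perfect_matchings_iso _ _ h).
  apply: inj_card_bij.
    move=> a b /(congr1 val) /=; case: a b => [u|f] [v|g] //= [].
      by move->.
    by move/(@ends_inj (del_edge e)) ->.
  (* Both sides have one element fewer than the vertices and edges of [G] together, so the injection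
     is bijective. *)
  rewrite card_sig; rewrite cardC1 !card_sum !card_edge card_edges_del_edge.
  by rewrite (cardsD1 (ends e) (edges G)) (valP e) addnS.
by case=> [u|f] [v|g].
Qed.

End DeleteEdge.

(** * The count for cubic graphs *)

Theorem theorem1p5 (G : sgraph) (n m : nat) (e : edge G)
    (Gconn : connected G) (Gcubic : cubic G)
    (Gn : #|G| = n) (Gm : #|edges G| = m) (m_odd : odd m)
    (e_noncut : non_cut_edge e) :
  [/\ num_perfect_matchings (middle_graph (del_edge e)) =
        num_perfect_matchings (del_vertex (middle_of_edge e)),
      num_perfect_matchings (del_vertex (middle_of_edge e)) =
        2 ^ (m - n) * 3 ^ ((2 * n - m - 1) %/ 2)
    & 2 ^ (m - n) * 3 ^ ((2 * n - m - 1) %/ 2) =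
        2 ^ (n %/ 2) * 3 ^ ((n - 2) %/ 4)].
Proof.
have nm : n * 3 = 2 * m.
  rewrite -Gm -handshake -Gn -sum_nat_const.
  by apply: eq_bigr => v _; rewrite Gcubic.
(* From [3n = 2m] follow [n = 2j] and [m = 3j]; as [m] is odd, so is [j], whence [n = 4k + 2]. *)
have [k [nE mE]] : exists k, n = 2 * k.*2.+1 /\ m = 3 * k.*2.+1.
  by exists (n %/ 4); lia.
rewrite -num_perfect_matchings_del_vertex; split=> //; last first.
  by congr (2 ^ _ * 3 ^ _); lia.
have subcubic (v : del_edge e) : degree v <= 3.
  by rewrite -(Gcubic v); apply: degree_del_edge.
have := num_perfect_matchings_middle subcubic e_noncut.
rewrite card_edges_del_edge Gm [#|del_edge e|]Gn => P; have {P} := P ltac:(lia).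
(* Since [n <= m], the factor [2 ^ n] can be split off and cancelled. *)
have -> : m.-1.+1 = n + (m - n) by lia.
have -> : (m.-1 - n) %/ 2 = (2 * n - m - 1) %/ 2 by lia.
by rewrite expnD -mulnA => /eqP; rewrite eqn_pmul2l ?expn_gt0 // => /eqP.
Qed.
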